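(* Let $\mathcal H$ be a Banach space, let $\{S(t)\}_{t\ge 0}$ be a semigroup of closed operators on $\mathcal H$, and suppose that for some $R_0>0$ the closed ball $\mathfrak B_0=B_{\mathcal H}(R_0)$ is an absorbing set for $S(t)$. Let $\mathcal V$ be a reflexive Banach space compactly embedded into $\mathcal H$. For every $x\in\mathfrak B_0$, let there exist two solution operators $V_x(t)$ and $U_x(t)$ on $\mathcal H$ with the following properties: (i) For every $x\in\mathfrak B_0$, any two vectors $y,z\in\mathcal H$ satisfying $y+z=x$, and every $t\ge 0$, $$S(t)x=V_x(t)y+U_x(t)z.$$ (ii) There is $\alpha\in\mathfrak D$ such that, for every $t\ge 0$, $$\sup_{x\in\mathfrak B_0}\|V_x(t)y\|_{\mathcal H}\le \alpha(t)\|y\|_{\mathcal H},\quad\forall y\in\mathfrak B_0.$$ (iii) There are $\beta\in\mathfrak D$ and $J\in\mathfrak I$ such that, for every $t\ge 0$, $$\sup_{x\in\mathfrak B_0}\|U_x(t)z\|_{\mathcal V}\le \beta(t)\|z\|_{\mathcal V}+J(t),\quad\forall z\in\mathcal V$$ (in particular $U_x(t)z\in\mathcal V$ for $z\in\mathcal V$). Then $\mathfrak B_0$ is exponentially attracted by a closed ball of $\mathcal V$; namely, there exist strictly positive constants $\varrho,K,\omega$ such that, for every $t\ge 0$, $$\mathrm{dist}_{\mathcal H}\big(S(t)\mathfrak B_0,B_{\mathcal V}(\varrho)\big)\le K e^{-\omega t}.$$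
   Context: Notation: $\mathbb R^+=[0,\infty)$. For a Banach space $X$ and $R\ge 0$, $B_X(R)=\{z\in X:\|z\|_X\le R\}$. $\mathfrak I$ is the set of continuous increasing functions $J:\mathbb R^+\to\mathbb R^+$; $\mathfrak D$ is the set of continuous decreasing functions $\beta:\mathbb R^+\to\mathbb R^+$ with $\beta(\infty):=\lim_{t\to\infty}\beta(t)<1$ (monotonicity is not required to be strict). A solution operator on a Banach space $X$ is a family of (possibly nonlinear) maps $U(t):X\to X$, $t\ge 0$, with $U(0)z=z$ for all $z\in X$. It is a semigroup if moreover $U(t+\tau)=U(t)U(\tau)$ for all $t,\tau\ge 0$. A semigroup $S(t)$ on $\mathcal H$ is a semigroup of closed operators if, for each fixed $t\ge 0$ and all $x_n,x,\xi\in\mathcal H$, $x_n\to x$ and $S(t)x_n\to\xi$ in $\mathcal H$ imply $\xi=S(t)x$. A bounded set $\mathfrak B_0\subset\mathcal H$ is absorbing for $S(t)$ if for every $R\ge 0$ there is $t_R\ge 0$ such that $S(t)\mathfrak B\subset\mathfrak B_0$ for all $t\ge t_R$ and all $\mathfrak B\subset B_{\mathcal H}(R)$. $\mathrm{dist}_{\mathcal H}(\mathfrak B_1,\mathfrak B_2)=\sup_{x_1\in\mathfrak B_1}\inf_{x_2\in\mathfrak B_2}\|x_1-x_2\|_{\mathcal H}$ is the Hausdorff semidistance. *)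

(* Defs.v *)
From HB Require Import structures.
From mathcomp Require Import all_boot all_order all_algebra.
From mathcomp Require Import all_classical all_reals all_analysis.
Set Implicit Arguments.
Unset Strict Implicit.
Unset Printing Implicit Defensive.
Import Order.TTheory GRing.Theory Num.Theory.
Import numFieldNormedType.Exports.
Local Open Scope classical_set_scope.
Local Open Scope ring_scope.

(* Time runs over [0, +oo[; functions of time are total on R and constrained
   there only. *)

Section FunctionClasses.
Variable R : realType.

Definition classI (J : R -> R) : Prop :=
  [/\ {within `[0, +oo[, continuous J},
      forall t : R, 0 <= t -> 0 <= J t
    & forall s t : R, 0 <= s -> s <= t -> J s <= J t].

Definition classD (b : R -> R) : Prop :=
  [/\ {within `[0, +oo[, continuous b},
      forall t : R, 0 <= t -> 0 <= b t,
      forall s t : R, 0 <= s -> s <= t -> b t <= b s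
    & exists2 l : R, b t @[t --> +oo] --> l & l < 1].

End FunctionClasses.

Definition cball (R : realType) (X : normedModType R) (r : R) : set X :=
  [set z | `|z| <= r].
Arguments cball {R} X r.

Section Spaces.
Variable R : realType.

Definition dual_space (X : normedModType R) : set (X -> R) :=
  [set f : X -> R | scalar f /\ continuous f].

Definition dual_norm (X : normedModType R) (f : X -> R) : R :=
  sup [set `|f v| | v in cball X 1].

(* Only the values of Phi on dual_space matter. *)
Definition bidual_space (X : normedModType R) : set ((X -> R) -> R) :=
  [set Phi : (X -> R) -> R |
    (forall (a : R) (f g : X -> R), dual_space f -> dual_space g ->
       Phi (fun v => a * f v + g v) = a * Phi f + Phi g) /\
    (exists C : R, forall f : X -> R, dual_space f ->
       `|Phi f| <= C * dual_norm f)].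

Definition reflexive_space (X : normedModType R) : Prop :=
  forall Phi : (X -> R) -> R, bidual_space Phi ->
    exists v : X, forall f : X -> R, dual_space f -> Phi f = f v.

(* V is seen as a subspace of H through the injection iota. *)
Definition compact_embedding (V H : normedModType R) (iota : V -> H) : Prop :=
  [/\ linear iota, injective iota, continuous iota
    & forall A : set V, bounded_set A -> precompact (iota @` A)].

Definition hausdorff_semidist (X : normedModType R) (A B : set X) : \bar R :=
  ereal_sup [set ereal_inf [set `|x - y|%:E | y in B] | x in A].

End Spaces.

Section Operators.
Variables (R : realType) (X : normedModType R).

Definition solution_operator (U : R -> X -> X) : Prop :=
  forall z, U 0 z = z.

Definition semigroup (S : R -> X -> X) : Prop :=
  solution_operator S /\
  forall t tau : R, 0 <= t -> 0 <= tau -> forall x, S (t + tau) x = S t (S tau x).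

Definition closed_semigroup (S : R -> X -> X) : Prop :=
  semigroup S /\
  forall t : R, 0 <= t -> forall (x_ : nat -> X) (x xi : X),
    x_ n @[n --> \oo] --> x -> S t (x_ n) @[n --> \oo] --> xi -> xi = S t x.

Definition absorbing (S : R -> X -> X) (B0 : set X) : Prop :=
  bounded_set B0 /\
  forall r : R, 0 <= r -> exists2 tr : R, 0 <= tr &
    forall t : R, tr <= t -> forall B : set X, B `<=` cball X r -> S t @` B `<=` B0.

End Operators.

(* Main.v *)
Require Import Defs.
From HB Require Import structures.
From mathcomp Require Import all_boot all_order all_algebra.
From mathcomp Require Import all_classical all_reals all_analysis.
From mathcomp Require Import ring lra.
Set Implicit Arguments.
Unset Strict Implicit.
Unset Printing Implicit Defensive.
Import Order.TTheory GRing.Theory Num.Theory.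
Import numFieldNormedType.Exports.
Local Open Scope classical_set_scope.
Local Open Scope ring_scope.

(** Pick [T > 0] beyond the absorption time of the ball with [alpha T <= a < 1]
    and [beta T <= b < 1]. Starting from [x = x + 0] and feeding the two summands
    produced by (i) at time [T] back into (i), now based at the point [S (n T) x]
    of the ball, gives [S (n T) x = y_n + z_n] with [`|y_n| <= a ^ n * R0] and
    [`|z_n|] at most the fixed point of [r |-> b * r + J T]. A last application
    of (i) for the remaining time in [0, T] costs only constant factors. *)

Section ClassD.
Variable R : realType.

(** The number [(l + 1) / 2] lies strictly between the limit [l] and 1. The maximum with [2^-1]
    keeps the bound positive, as the later use of [ln a] and [a^-1] requires. *)
Lemma classD_near_le (b : R -> R) : classD b ->
  exists a : R, [/\ 0 < a, a < 1 & \forall t \near +oo, b t <= a].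
Proof.
move=> [_ _ _ [l bl l1]]; exists (Num.max (2^-1) ((l + 1) / 2)).
have la : l < Num.max (2^-1) ((l + 1) / 2).
  by rewrite lt_max; apply/orP; right; rewrite ltr_pdivlMr//; lra.
split; first by rewrite lt_max invr_gt0 ltr0n.
  by rewrite gt_max invf_lt1 ?ltr0n// ltr1n/= ltr_pdivrMr//; lra.
exact: cvgr_le bl _ la.
Qed.

Lemma classD_le0 (b : R -> R) (t : R) : classD b -> 0 <= t -> b t <= b 0.
Proof. by move=> [_ _ bd _] t0; apply: bd. Qed.

End ClassD.

Lemma hausdorff_semidist_le (R : realType) (X : normedModType R) (A B : set X)
    (d : R) :
  (forall x, A x -> exists2 y, B y & `|x - y| <= d) ->
  (hausdorff_semidist A B <= d%:E)%E.
Proof.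
move=> AB; apply: ge_ereal_sup => _ [x Ax <-].
have [y By xyd] := AB _ Ax.
apply: (@le_trans _ _ `|x - y|%:E); last by rewrite lee_fin.
by apply: ereal_inf_lbound; exists y.
Qed.

(** Since [t / T < n + 1] and [ln a < 0], [a ^+ n.+1] is at most the exponential of
    [(t / T) * ln a]; the factor [a^-1] pays for the extra power. *)
Lemma expr_truncn_le (R : realType) (a T t : R) : 0 < a -> a < 1 -> 0 < T ->
  0 <= t ->
  a ^+ Num.truncn (t / T) <= a^-1 * expR (- (- ln a / T) * t).
Proof.
move=> a0 a1 T0 t0.
have lna : ln a < 0 by rewrite ln_lt0// a0.
have /truncn_itv/andP[_] : 0 <= t / T by rewrite divr_ge0// ltW.
set n := Num.truncn _ => tn.
rewrite -[leRHS]mul1r mulrA -ler_pdivrMl ?mulr_gt0 ?invr_gt0 ?mul1r//.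
rewrite invrK -exprS -{1}(lnK a0) -expRM_natl ler_expR.
have -> : - (- ln a / T) * t = (t / T) * ln a by ring.
by apply: ler_wnM2r; exact: ltW.
Qed.

Section Decomposition.
Variables (R : realType) (H V : normedModType R) (S : R -> H -> H).
Variables (iota : V -> H) (B : set H) (T a b c M r : R).
Hypotheses (hS : semigroup S) (T0 : 0 <= T) (a0 : 0 <= a) (b0 : 0 <= b).
Hypothesis SB : forall x, B x -> B (S T x).
Hypothesis a1 : a <= 1.
Hypothesis step : forall x, B x -> forall y z, x = y + iota z -> `|y| <= M ->
  exists y' z', [/\ S T x = y' + iota z', `|y'| <= a * `|y|
    & `|z'| <= b * `|z| + c].
Hypothesis br : b * r + c <= r.

(** Induction on [n]: [a <= 1] keeps the first summand below [M], so that [step] applies again, and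
    [br] makes the ball of radius [r] stable for the second. *)
Lemma iterated_decomposition (n : nat) (x y : H) (z : V) :
  B x -> x = y + iota z -> `|y| <= M -> `|z| <= r ->
  B (S (n%:R * T) x) /\ exists y' z', [/\ S (n%:R * T) x = y' + iota z',
    `|y'| <= a ^+ n * M & `|z'| <= r].
Proof.
move=> Bx xE yM zr; elim: n => [|n [Bn [y1 [z1 [E1 y1M z1r]]]]].
  by rewrite mul0r hS.1 expr0 mul1r; split=> //; exists y, z.
have M0 : 0 <= M := le_trans (normr_ge0 _) yM.
have -> : n.+1%:R * T = T + n%:R * T by rewrite -natr1 mulrDl mul1r addrC.
rewrite hS.2 ?mulr_ge0//; split; first exact: SB.
have {}y1M' : `|y1| <= M.
  by rewrite (le_trans y1M)// ler_piMl// exprn_ile1.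
have [y2 [z2 [E2 y2M z2r]]] := step Bn E1 y1M'.
exists y2, z2; split=> //.
  by rewrite exprS -mulrA (le_trans y2M)// ler_wpM2l.
by rewrite (le_trans z2r)// (le_trans _ br)// lerD2r ler_wpM2l.
Qed.

End Decomposition.

Theorem theorem3p2 (R : realType) (H V : completeNormedModType R)
  (S : R -> H -> H) (R0 : R) (iota : V -> H) (Vop Uop : H -> R -> H -> H)
  (hS : closed_semigroup S)
  (hR0 : 0 < R0)
  (habs : absorbing S (cball H R0))
  (hrefl : reflexive_space V)
  (hemb : compact_embedding iota)
  (hV : forall x, cball H R0 x -> solution_operator (Vop x))
  (hU : forall x, cball H R0 x -> solution_operator (Uop x))
  (h1 : forall x, cball H R0 x -> forall y z : H, y + z = x ->
     forall t : R, 0 <= t -> S t x = Vop x t y + Uop x t z)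
  (h2 : exists2 alpha : R -> R, classD alpha &
     forall t : R, 0 <= t -> forall y, cball H R0 y ->
       (ereal_sup [set `|Vop x t y|%:E | x in cball H R0]
          <= (alpha t * `|y|)%:E)%E)
  (* w is the element U_x(t)z of V *)
  (h3 : exists beta J : R -> R, [/\ classD beta, classI J &
     forall t : R, 0 <= t -> forall z : V, forall x, cball H R0 x ->
       exists2 w : V, iota w = Uop x t (iota z) &
         `|w| <= beta t * `|z| + J t]) :
  exists rho K omega : R,
    [/\ 0 < rho, 0 < K, 0 < omega &
      forall t : R, 0 <= t ->
        (hausdorff_semidist (S t @` cball H R0) (iota @` cball V rho)
           <= (K * expR (- omega * t))%:E)%E].
Proof.
have {}hS := hS.1; have [_ {}habs] := habs.
have [alpha alphaD {}h2] := h2; have [beta [J [betaD JI {}h3]]] := h3.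
have iota0 : iota 0 = 0.
  by have [iotaL _ _ _] := hemb; have := iotaL (-1) 0 0; rewrite !scaleN1r !addNr.
have [_ alpha0 _ _] := alphaD; have [_ beta0 _ _] := betaD.
have [_ J0 Jle] := JI.
have [a [a_gt0 a_lt1 alpha_near]] := classD_near_le alphaD.
have [b [b_gt0 b_lt1 beta_near]] := classD_near_le betaD.
have [tA _ SB] := habs _ (ltW hR0).
have [T [T_gt0 tAT alphaT betaT]] :
    exists T, [/\ 0 < T, tA <= T, alpha T <= a & beta T <= b].
  near (+oo : set_system R) => T; exists T.
  split; near: T => //.
  - by apply: nbhs_pinfty_gt; exact: num_real.
  - by apply: nbhs_pinfty_ge; exact: num_real.
(* The time is left free: the iteration uses [T], the last application the remainder [s]. *)
have step t : 0 <= t -> forall x, cball H R0 x -> forall y z,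
    x = y + iota z -> `|y| <= R0 -> exists y' z', [/\ S t x = y' + iota z',
    `|y'| <= alpha t * `|y| & `|z'| <= beta t * `|z| + J t].
  move=> t_ge0 x Bx y z xE yR0.
  have [w wE wle] := h3 _ t_ge0 z _ Bx.
  exists (Vop x t y), w; split=> //; first by rewrite wE; exact: h1.
  rewrite -lee_fin; apply: le_trans (h2 _ t_ge0 _ yR0).
  by apply: ereal_sup_ubound; exists x.
pose r := J T / (1 - b).
have JT := J0 _ (ltW T_gt0).
have r_ge0 : 0 <= r by rewrite divr_ge0// subr_ge0 ltW.
have br : b * r + J T <= r.
  by rewrite /r le_eqVlt; apply/orP; left; apply/eqP; field; lra.
have stepT x : cball H R0 x -> forall y z, x = y + iota z -> `|y| <= R0 ->
    exists y' z', [/\ S T x = y' + iota z', `|y'| <= a * `|y|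
    & `|z'| <= b * `|z| + J T].
  move=> Bx y z xE yR0.
  have [y' [z' [E yle zle]]] := step _ (ltW T_gt0) _ Bx _ _ xE yR0.
  exists y', z'; split=> //; first by rewrite (le_trans yle)// ler_wpM2r.
  by rewrite (le_trans zle)// lerD2r ler_wpM2r.
have SBT x : cball H R0 x -> cball H R0 (S T x).
  by move=> Bx; apply: (SB _ tAT _ (@subset_refl _ _)); exists x.
have alpha00 := alpha0 _ (lexx 0); have beta00 := beta0 _ (lexx 0).
(* For a remainder [s] in [0, T], monotonicity gives [beta s <= beta 0], [J s <= J T] and
   [alpha s <= alpha 0]. The added 1's ensure strict positivity, and the division by [a] accounts
   for rounding [t / T] down. *)
exists (beta 0 * r + J T + 1), ((alpha 0 + 1) * R0 / a), (- ln a / T); split.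
- by rewrite ltr_wpDl// addr_ge0// mulr_ge0.
- by rewrite divr_gt0// mulr_gt0// ltr_wpDl.
- by rewrite divr_gt0// oppr_gt0 ln_lt0// a_gt0.
move=> t t_ge0; apply: hausdorff_semidist_le => _ [x Bx <-].
pose n := Num.truncn (t / T); pose s := t - n%:R * T.
have /truncn_itv/andP[nt tn] : 0 <= t / T by rewrite divr_ge0// ltW.
have s_ge0 : 0 <= s.
  by rewrite subr_ge0 -ler_pdivlMr.
have s_leT : s <= T.
  by rewrite lerBlDr -{1}[T]mul1r -mulrDl addrC natr1 -ler_pdivrMr// ltW.
have x0 : x = x + iota 0 by rewrite iota0 addr0.
have z0r : `|0 : V| <= r by rewrite normr0.
have [Bn [y [z [En yn zn]]]] := iterated_decomposition hS (ltW T_gt0)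
  (ltW a_gt0) (ltW b_gt0) SBT (ltW a_lt1) stepT br n Bx x0 Bx z0r.
have anR : a ^+ n * R0 <= R0.
  by rewrite ler_piMl ?(ltW hR0)// exprn_ile1 ?ltW.
have [y' [z' [E yle zle]]] := step _ s_ge0 _ Bn _ _ En (le_trans yn anR).
have tE : t = s + n%:R * T by rewrite subrK.
have {}E : S t x = y' + iota z'.
  by rewrite tE hS.2// mulr_ge0// ltW.
(* The approximating point is the regular summand, so the distance to it is the norm of [y']. *)
exists (iota z').
  exists z' => //; rewrite /cball/= (le_trans zle)//.
  have : beta s * `|z| <= beta 0 * r.
    by rewrite ler_pM// ?beta0// classD_le0.
  have := Jle _ _ s_ge0 s_leT; lra.
rewrite E addrK (le_trans yle)//.
(* Regrouped to match the factors of [alpha s * |y|], with [|y| <= a ^+ n * R0]. *)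
have -> : forall e, (alpha 0 + 1) * R0 / a * e = (alpha 0 + 1) * (R0 * (a^-1 * e)).
  by move=> e; ring.
apply: ler_pM => //; first exact: alpha0.
  by rewrite (le_trans (classD_le0 alphaD s_ge0))// lerDl.
by rewrite (le_trans yn)// mulrC ler_wpM2l ?(ltW hR0)// expr_truncn_le.
Unshelve. all: by end_near.
Qed.
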